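(* Let $k \geq 2$ and let $P_1, P_2, \ldots, P_k$ be finite families of Euclidean disks of diameter $1$ in the plane $\mathbb{R}^2$. Suppose that $B' \cap B'' \neq \varnothing$ for every pair $(B', B'')$ such that $B' \in P_i$, $B'' \in P_j$ and $i \neq j$. Then there exists $m \in \{1,2,\ldots,k\}$ such that $\pi\left(\bigcup_{i \neq m} P_i\right) \le 3$.
   Context: For a family $\mathcal{F}$ of convex sets in $\mathbb{R}^d$, the piercing number $\pi(\mathcal{F})$ is the smallest positive integer $k$ such that there is a set of $k$ points in $\mathbb{R}^d$ that intersects every element of $\mathcal{F}$. Thus $\pi(\mathcal{F}) \le 3$ means that there are three points such that every member of $\mathcal{F}$ contains at least one of them. Here $\bigcup_{i \ne m} P_i$ denotes the union of the families, i.e. the family of all disks belonging to some $P_i$ with $i \neq m$. Disks are closed. *)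

(* Defs.v *)
From mathcomp Require Import all_boot all_order all_algebra.
From mathcomp Require Import all_classical all_reals.

Set Implicit Arguments.
Unset Strict Implicit.
Unset Printing Implicit Defensive.

Import GRing.Theory Num.Theory.

Local Open Scope ring_scope.
Local Open Scope classical_set_scope.

(* The norm that MathComp-Analysis puts on row vectors is the sup norm, hence
   this explicit Euclidean distance. *)
Definition eucl_dist (R : realType) (d : nat) (x y : 'rV[R]_d) : R :=
  Num.sqrt (\sum_(i < d) (x 0 i - y 0 i) ^+ 2).

(* The second argument is the diameter, not the radius. *)
Definition closed_disk (R : realType) (c : 'rV[R]_2) (diam : R) :
    set 'rV[R]_2 :=
  [set x | eucl_dist c x <= diam / 2].

Definition pierces (R : realType) (d : nat) (X : set 'rV[R]_d)
    (F : set (set 'rV[R]_d)) : Prop :=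
  forall B, F B -> X `&` B !=set0.

Definition pierceable (R : realType) (d : nat) (F : set (set 'rV[R]_d))
    (n : nat) : Prop :=
  exists X : set 'rV[R]_d, (X #= `I_n)%card /\ pierces X F.

(* A relation rather than a function, since a family that no finite set of
   points pierces has no piercing number. *)
Definition is_piercing_number (R : realType) (d : nat)
    (F : set (set 'rV[R]_d)) (n : nat) : Prop :=
  [/\ (0 < n)%N, pierceable F n &
      forall j : nat, (0 < j)%N -> pierceable F j -> (n <= j)%N].

(* Main.v *)
(* Call [a], [b] the centers of two disks; the disks meet iff [|a - b| <= 1].
   If all centers are pairwise at distance at most 23/20 < 2/sqrt 3, then by
   Pal's theorem they lie in a regular hexagon of width 23/20, which three disks
   of diameter 1 cover.  Otherwise two centers [c], [c'] at distance at least
   23/20 come from the same family [P m], so every center of the other families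
   lies within distance 1 of both [c] and [c']; this lens is so thin that three
   disks of diameter 1 stacked along its axis cover it. *)
Require Import Defs.
From mathcomp Require Import all_boot all_order all_algebra.
From mathcomp Require Import all_classical all_reals.
From mathcomp Require Import topology normedtype ring lra.

Import Order.TTheory GRing.Theory Num.Theory numFieldNormedType.Exports.

Local Open Scope ring_scope.
Local Open Scope classical_set_scope.

(** * Covering a thin lens and a regular hexagon by three disks *)

(* Coordinates along and across the line through the two centers [(d/2, 0)]
   and [(- d/2, 0)]. *)
Lemma lens_cover (R : realFieldType) (x y d : R) : 23/20 <= d ->
  (x - d/2) ^+ 2 + y ^+ 2 <= 1 -> (x + d/2) ^+ 2 + y ^+ 2 <= 1 ->
  [\/ x ^+ 2 + y ^+ 2 <= 1/4, x ^+ 2 + (y - 2/5) ^+ 2 <= 1/4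
    | x ^+ 2 + (y + 2/5) ^+ 2 <= 1/4].
Proof.
move=> hd h1 h2.
have [h0|h0] := lerP (x ^+ 2 + y ^+ 2) (1/4); first by constructor 1.
wlog hx : x h0 h1 h2 / 0 <= x.
  move=> H; have [hx|hx] := lerP 0 x; first exact: H.
  by have := H (- x); rewrite !sqrrN; apply => //; [nra|nra|lra].
(* As [x] is nonnegative, the center [(- d/2, 0)] is the farther one, and its bound survives
   shrinking [d] to 23/20. *)
have h3 : (x + 23/40) ^+ 2 + y ^+ 2 <= 1 by nra.
have key (z : R) : 0 <= z -> 1/4 < x ^+ 2 + z ^+ 2 ->
    (x + 23/40) ^+ 2 + z ^+ 2 <= 1 -> x ^+ 2 + (z - 2/5) ^+ 2 <= 1/4.
  move=> hz {h0 h1 h2 h3} h0 h3.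
  (* Subtracting the two bounds leaves one that is linear in [x]; being outside the central disk
     then keeps [z] away from 0. *)
  have hx2 : x <= 11/30 by nra.
  have hz2 : 1/3 <= z by nra.
  nra.
have [hy|hy] := lerP 0 y; first by constructor 2; apply: key.
constructor 3; have := key (- y); rewrite sqrrN => /(_ _ h0 h3) H.
have := H ltac:(lra); nra.
Qed.

(** With [a], [b], [c] the signed distances in three directions at 120 degrees, the left side is the
    squared distance to the disk center in the direction of [a]. Where [a] is largest, its maximum
    over the hexagon is 3/4 (23/40)^2 < 1/4, reached at side midpoints such as [a = b = 23/80]. *)
Lemma hexagon_piece (R : realFieldType) (a b c : R) :
  a + b + c = 0 -> b <= a -> c <= a ->
  - (23/40) <= b -> - (23/40) <= c -> a <= 23/40 ->
  4/3 * (a ^+ 2 + a * b + b ^+ 2) - 23/40 * a + (23/80) ^+ 2 <= 1/4.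
Proof.
move=> abc ba ca hb hc ha.
have ec : c = - a - b by lra.
have -> : a ^+ 2 + a * b + b ^+ 2 = a ^+ 2 - b * c by rewrite ec; ring.
(* Near the center the lines [a = b] and [a = c] bound the piece, farther out the sides
   [b = - 23/40] and [c = - 23/40]. *)
have [h|h] := lerP a (23/80).
- have bc : 0 <= (a - b) * (a - c) by rewrite mulr_ge0 // subr_ge0.
  have q : 0 <= a * (23/80 - a) by rewrite mulr_ge0; lra.
  rewrite ec in bc *; lra.
- have bc : 0 <= (b + 23/40) * (c + 23/40) by rewrite mulr_ge0; lra.
  have q : 0 <= (a - 23/80) * (23/40 - a) by rewrite mulr_ge0; lra.
  rewrite ec in bc *; lra.
Qed.

(* The strips bound the hexagon in coordinates along and across one of its three
   directions, with [r = sqrt 3]; the disks are centered at distance 23/80 from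
   its center in these three directions. *)
Lemma hexagon_cover (R : realFieldType) (r x y : R) : r ^+ 2 = 3 ->
  `|x| <= 23/40 -> `|- x / 2 + r / 2 * y| <= 23/40 ->
  `|- x / 2 - r / 2 * y| <= 23/40 ->
  [\/ (x - 23/80) ^+ 2 + y ^+ 2 <= 1/4,
      (x + 23/160) ^+ 2 + (y - r * (23/160)) ^+ 2 <= 1/4
    | (x + 23/160) ^+ 2 + (y + r * (23/160)) ^+ 2 <= 1/4].
Proof.
move=> r2.
set u := - x / 2 + r / 2 * y; set v := - x / 2 - r / 2 * y.
have yuv : y = r * ((u - v) / 3).
  have -> : r * ((u - v) / 3) = r ^+ 2 * y / 3 by rewrite /u /v; field.
  by rewrite r2; field.
have xuv : x + u + v = 0 by rewrite /u /v; field.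
have ex : x = - u - v by lra.
have E1 : (x - 23/80) ^+ 2 + y ^+ 2 =
    4/3 * (x ^+ 2 + x * u + u ^+ 2) - 23/40 * x + (23/80) ^+ 2.
  by rewrite {1}yuv exprMn r2 ex; field.
have E2 : (x + 23/160) ^+ 2 + (y - r * (23/160)) ^+ 2 =
    4/3 * (u ^+ 2 + u * v + v ^+ 2) - 23/40 * u + (23/80) ^+ 2.
  by rewrite {1}yuv -mulrBr exprMn r2 ex; field.
have E3 : (x + 23/160) ^+ 2 + (y + r * (23/160)) ^+ 2 =
    4/3 * (v ^+ 2 + v * x + x ^+ 2) - 23/40 * v + (23/80) ^+ 2.
  by rewrite {1}yuv -mulrDr exprMn r2 ex; field.
rewrite E1 E2 E3 !ler_norml => /andP[x1 x2] /andP[u1 u2] /andP[v1 v2].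
clear E1 E2 E3 yuv ex; clearbody u v.
(* The largest of [x], [u], [v] selects the disk. *)
have [ux|ux] := lerP u x; have [vx|vx] := lerP v x.
- by constructor 1; apply: (@hexagon_piece _ x u v).
- by constructor 3; apply: (@hexagon_piece _ v x u); lra.
- by constructor 2; apply: (@hexagon_piece _ u v x); lra.
- have [uv|uv] := lerP u v.
  + by constructor 3; apply: (@hexagon_piece _ v x u); lra.
  + by constructor 2; apply: (@hexagon_piece _ u v x); lra.
Qed.

(** * Two far centers in arbitrary position *)

Definition sqdist {R : realType} (p q : R * R) : R :=
  (p.1 - q.1) ^+ 2 + (p.2 - q.2) ^+ 2.

Definition covered_by_three {R : realType} (S : set (R * R)) : Prop :=
  exists w1 w2 w3 : R * R, forall p, S p ->
    [\/ sqdist p w1 <= 1/4, sqdist p w2 <= 1/4 | sqdist p w3 <= 1/4].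

Lemma far_pair_cover (R : realType) (c c' : R * R) :
  (23/20) ^+ 2 <= sqdist c c' ->
  covered_by_three [set p | sqdist p c <= 1 /\ sqdist p c' <= 1].
Proof.
move=> hcc; set d := Num.sqrt (sqdist c c').
have d_ge : 23/20 <= d.
  by rewrite -(@ger0_norm _ (23/20)) ?ler_sqrt -?sqrtr_sqr ?ler_wsqrtr //; lra.
have d2 : d ^+ 2 = sqdist c c' by rewrite sqr_sqrtr // /sqdist addr_ge0 // sqr_ge0.
have d0 : d != 0 by apply/eqP; lra.
pose a := (c.1 - c'.1) / d; pose b := (c.2 - c'.2) / d.
have ab1 : a ^+ 2 + b ^+ 2 = 1.
  by rewrite /a /b !expr_div_n -mulrDl -/(sqdist c c') -d2 divff // expf_neq0.
have c1 : c.1 - c'.1 = a * d by rewrite /a divfK.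
have c2 : c.2 - c'.2 = b * d by rewrite /b divfK.
clearbody a b.
pose m1 := (c.1 + c'.1) / 2; pose m2 := (c.2 + c'.2) / 2.
have ec1 : c.1 = m1 + a * d / 2 by rewrite /m1 -c1; field.
have ec2 : c.2 = m2 + b * d / 2 by rewrite /m2 -c2; field.
have ec'1 : c'.1 = m1 - a * d / 2 by rewrite /m1 -c1; field.
have ec'2 : c'.2 = m2 - b * d / 2 by rewrite /m2 -c2; field.
(* The midpoint of [c] and [c'], and its translates by 2/5 perpendicular to their line. *)
exists (m1, m2), (m1 - 2/5 * b, m2 + 2/5 * a), (m1 + 2/5 * b, m2 - 2/5 * a).
move=> [p1 p2] [] /=; rewrite /sqdist /= ec1 ec2 ec'1 ec'2 => h1 h2.
pose x := (p1 - m1) * a + (p2 - m2) * b.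
pose y := (p2 - m2) * a - (p1 - m1) * b.
have E z w : (p1 - (m1 + z * a - w * b)) ^+ 2 + (p2 - (m2 + z * b + w * a)) ^+ 2
   = (x - z) ^+ 2 + (y - w) ^+ 2.
  (* The added multiple of [a ^+ 2 + b ^+ 2 - 1] turns the invariance of distance under rotation
     into a polynomial identity. *)
  have -> : (x - z) ^+ 2 + (y - w) ^+ 2 =
    (p1 - (m1 + z * a - w * b)) ^+ 2 + (p2 - (m2 + z * b + w * a)) ^+ 2
    + ((p1 - m1) ^+ 2 + (p2 - m2) ^+ 2 - z ^+ 2 - w ^+ 2) * (a ^+ 2 + b ^+ 2 - 1).
    by rewrite /x /y; ring.
  by rewrite ab1 subrr mulr0 addr0.
have E1 := E (d/2) 0; have E2 := E (- d/2) 0.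
have E3 := E 0 0; have E4 := E 0 (2/5); have E5 := E 0 (-2/5).
clear E; clearbody x y.
have [||h|h|h] := @lens_cover _ x y d d_ge; [lra|lra| | |].
- by constructor 1; lra.
- by constructor 2; lra.
- by constructor 3; lra.
Qed.

(** * Support functions and balanced directions *)

(** Splitting off [p0] keeps the point set nonempty, so that the maximum is attained. *)
Definition support {R : realType} (p0 : R * R) (s : seq (R * R)) (a b : R) : R :=
  foldr (fun p m => Num.max (p.1 * a + p.2 * b) m) (p0.1 * a + p0.2 * b) s.

Lemma support_ge (R : realType) (p0 : R * R) s a b p : p \in p0 :: s ->
  p.1 * a + p.2 * b <= support p0 s a b.
Proof.
elim: s p => [|q s ih] p; first by rewrite inE => /eqP ->.
rewrite !inE => /or3P[/eqP ->|/eqP ->|ps]; rewrite /= le_max.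
- by rewrite ih ?mem_head ?orbT.
- by rewrite lexx.
- by rewrite ih ?inE ?ps ?orbT.
Qed.

Lemma support_attained (R : realType) (p0 : R * R) s a b :
  exists2 p, p \in p0 :: s & support p0 s a b = p.1 * a + p.2 * b.
Proof.
elim: s => [|q s [p ps ih]]; first by exists p0 => //; rewrite mem_head.
rewrite /= /Order.max; case: ifP => _; last by exists q; rewrite ?inE ?eqxx ?orbT.
by exists p => //; move: ps; rewrite !inE => /orP[->|->] //; rewrite !orbT.
Qed.

Lemma support_continuous (R : realType) (p0 : R * R) s (a b : R -> R) :
  continuous a -> continuous b -> continuous (fun t => support p0 s (a t) (b t)).
Proof.
move=> ca cb.
have lin (p : R * R) : continuous (fun t => p.1 * a t + p.2 * b t).
  move=> t; apply: cvgD; apply: cvgM;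
    [exact: cvg_cst|exact: ca|exact: cvg_cst|exact: cb].
elim: s => [|q s ih] t; first exact: (lin p0).
exact: (continuous_max (lin q t) (ih t)).
Qed.

(* The three directions are [(a, b)] and its images under the rotations by 120
   and 240 degrees, for [r = sqrt 3].  When the imbalance vanishes, the center
   lines of the supporting strips in these directions are concurrent, so that
   the strips fit into a regular hexagon. *)
Definition imbalance {R : realType} (p0 : R * R) s (r a b : R) : R :=
  (support p0 s a b - support p0 s (- a) (- b))
  + (support p0 s (- a / 2 - r / 2 * b) (r / 2 * a - b / 2)
     - support p0 s (- (- a / 2 - r / 2 * b)) (- (r / 2 * a - b / 2)))
  + (support p0 s (- a / 2 + r / 2 * b) (- (r / 2) * a - b / 2)
     - support p0 s (- (- a / 2 + r / 2 * b)) (- (- (r / 2) * a - b / 2))).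

(** Reversing the direction swaps the two support values of each strip; this gives the sign change
    for the intermediate value theorem. *)
Lemma imbalanceN (R : realType) (p0 : R * R) s (r a b : R) :
  imbalance p0 s r (- a) (- b) = - imbalance p0 s r a b.
Proof.
rewrite /imbalance.
have -> : - - a / 2 - r / 2 * - b = - (- a / 2 - r / 2 * b) by ring.
have -> : r / 2 * - a - - b / 2 = - (r / 2 * a - b / 2) by ring.
have -> : - - a / 2 + r / 2 * - b = - (- a / 2 + r / 2 * b) by ring.
have -> : - (r / 2) * - a - - b / 2 = - (- (r / 2) * a - b / 2) by ring.
by rewrite !opprK; ring.
Qed.

Lemma imbalance_continuous (R : realType) (p0 : R * R) s r (a b : R -> R) :
  continuous a -> continuous b ->
  continuous (fun t => imbalance p0 s r (a t) (b t)).
Proof.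
move=> ca cb.
have lin (k l : R) : continuous (fun t => k * a t + l * b t).
  move=> t; apply: cvgD; apply: cvgM;
    [exact: cvg_cst|exact: ca|exact: cvg_cst|exact: cb].
have sup (k l k' l' : R) :
  continuous (fun t => support p0 s (k * a t + l * b t) (k' * a t + l' * b t)).
  by apply: support_continuous; exact: lin.
have -> : (fun t => imbalance p0 s r (a t) (b t)) = (fun t =>
  (support p0 s (1 * a t + 0 * b t) (0 * a t + 1 * b t)
    - support p0 s (-1 * a t + 0 * b t) (0 * a t + -1 * b t))
  + (support p0 s (-1/2 * a t + -r/2 * b t) (r/2 * a t + -1/2 * b t)
     - support p0 s (1/2 * a t + r/2 * b t) (-r/2 * a t + 1/2 * b t))
  + (support p0 s (-1/2 * a t + r/2 * b t) (-r/2 * a t + -1/2 * b t)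
     - support p0 s (1/2 * a t + -r/2 * b t) (r/2 * a t + 1/2 * b t))).
  by apply/funext => t; rewrite /imbalance; congr ((_ - _) + (_ - _) + (_ - _));
    congr (support _ _ _ _); field.
by move=> t; apply: cvgD; [apply: cvgD|]; apply: cvgB; exact: sup.
Qed.

(* Along the rational half circle from [(0, -1)] to [(0, 1)] the imbalance
   changes sign. *)
Lemma balanced_direction (R : realType) (p0 : R * R) s (r : R) :
  exists a b : R, a ^+ 2 + b ^+ 2 = 1 /\ imbalance p0 s r a b = 0.
Proof.
pose a (t : R) := (1 - t * t) * (1 + t * t)^-1.
pose b (t : R) := (t + t) * (1 + t * t)^-1.
have den t : 1 + t * t != 0 :> R by apply/eqP; nra.
have cid : continuous (fun t : R => t) by move=> t; exact: cvg_id.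
have csq : continuous (fun t : R => t * t) by move=> t; apply: cvgM; exact: cid.
have cden : continuous (fun t : R => (1 + t * t)^-1).
  by move=> t; apply: cvgV; [exact: den|apply: cvgD; [exact: cvg_cst|exact: csq]].
have cf : continuous (fun t => imbalance p0 s r (a t) (b t)).
  apply: imbalance_continuous => t; apply: cvgM; try exact: cden.
    by apply: cvgB; [exact: cvg_cst|exact: csq].
  by apply: cvgD; exact: cid.
have fN1 : imbalance p0 s r (a (-1)) (b (-1)) = - imbalance p0 s r (a 1) (b 1).
  by rewrite -imbalanceN /a /b; congr (imbalance _ _ _ _ _); field.
have [|t _ ft] := IVT (ltac:(lra) : (-1 : R) <= 1) (continuous_subspaceT cf) (v := 0).
  by rewrite fN1 ge_min le_max oppr_le0 oppr_ge0 !le_total.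
exists (a t), (b t); split => //; rewrite /a /b; field; exact: den.
Qed.

(** * Covering a finite set of diameter at most 23/20 *)

(** In a balanced direction the center lines of the three supporting strips concur. Widening each
    strip to 23/20 around its center line gives a regular hexagon, to which [hexagon_cover]
    applies. *)
Lemma small_diameter_cover (R : realType) (s : seq (R * R)) :
  {in s &, forall p q, sqdist p q <= (23/20) ^+ 2} ->
  covered_by_three [set` s].
Proof.
case: s => [|p0 s] hs; first by exists 0, 0, 0.
pose r : R := Num.sqrt 3.
have r2 : r ^+ 2 = 3 by rewrite sqr_sqrtr.
have [a [b [ab1 bal]]] := balanced_direction R p0 s r.
pose H := support p0 s.
have width u v : u ^+ 2 + v ^+ 2 = 1 -> H u v + H (- u) (- v) <= 23/20.
  move=> uv1; rewrite /H.
  have [p ps ->] := support_attained R p0 s u v.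
  have [q qs ->] := support_attained R p0 s (- u) (- v).
  have := hs p q ps qs; rewrite /sqdist.
  set x := p.1 - q.1; set y := p.2 - q.2 => xy.
  have -> : p.1 * u + p.2 * v + (q.1 * - u + q.2 * - v) = x * u + y * v.
    by rewrite /x /y; ring.
  (* Lagrange's identity; dropping the second square yields Cauchy-Schwarz. *)
  have e : (x * u + y * v) ^+ 2 + (x * v - y * u) ^+ 2 = x ^+ 2 + y ^+ 2.
    by rewrite -[RHS]mulr1 -uv1; ring.
  have sq := sqr_ge0 (x * v - y * u).
  nra.
have strip u v p : u ^+ 2 + v ^+ 2 = 1 -> p \in p0 :: s ->
    `|p.1 * u + p.2 * v - (H u v - H (- u) (- v)) / 2| <= 23/40.
  move=> uv1 ps; have w := width u v uv1.
  have h1 : p.1 * u + p.2 * v <= H u v := support_ge R p0 s u v p ps.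
  have h2 : p.1 * - u + p.2 * - v <= H (- u) (- v).
    exact: (support_ge R p0 s (- u) (- v) p ps).
  rewrite ler_norml; apply/andP; split; lra.
pose u2 := - a / 2 - r / 2 * b; pose v2 := r / 2 * a - b / 2.
pose u3 := - a / 2 + r / 2 * b; pose v3 := - (r / 2) * a - b / 2.
have uv2 : u2 ^+ 2 + v2 ^+ 2 = 1.
  have -> : u2 ^+ 2 + v2 ^+ 2 = (1 + r ^+ 2) / 4 * (a ^+ 2 + b ^+ 2).
    by rewrite /u2 /v2; field.
  by rewrite ab1 r2; field.
have uv3 : u3 ^+ 2 + v3 ^+ 2 = 1.
  have -> : u3 ^+ 2 + v3 ^+ 2 = (1 + r ^+ 2) / 4 * (a ^+ 2 + b ^+ 2).
    by rewrite /u3 /v3; field.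
  by rewrite ab1 r2; field.
pose m1 := (H a b - H (- a) (- b)) / 2.
pose m2 := (H u2 v2 - H (- u2) (- v2)) / 2.
pose m3 := (H u3 v3 - H (- u3) (- v3)) / 2.
have m0 : m1 + m2 + m3 = 0.
  rewrite /m1 /m2 /m3 -!mulrDl; apply/eqP; rewrite mulf_eq0; apply/orP; left.
  by rewrite -bal.
(* [pt m1 n] is the common point of the three center lines, found from [r * n = m2 - m3]; the disk
   centers lie at distance 23/80 from it. *)
pose n := r * (m2 - m3) / 3.
pose pt z w := (z * a - w * b, z * b + w * a).
exists (pt (m1 + 23/80) n), (pt (m1 - 23/160) (n + r * (23/160))),
  (pt (m1 - 23/160) (n - r * (23/160))) => p /= ps.
pose x := p.1 * a + p.2 * b - m1; pose y := p.2 * a - p.1 * b - n.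
have E z w : sqdist p (pt z w) = (x - (z - m1)) ^+ 2 + (y - (w - n)) ^+ 2.
  have -> : (x - (z - m1)) ^+ 2 + (y - (w - n)) ^+ 2 = sqdist p (pt z w)
    + (p.1 ^+ 2 + p.2 ^+ 2 - z ^+ 2 - w ^+ 2) * (a ^+ 2 + b ^+ 2 - 1).
    by rewrite /x /y /sqdist /=; ring.
  by rewrite ab1 subrr mulr0 addr0.
have rn : r * n = m2 - m3.
  have -> : r * n = r ^+ 2 * (m2 - m3) / 3 by rewrite /n; field.
  by rewrite r2; field.
have x2 : - x / 2 + r / 2 * y = p.1 * u2 + p.2 * v2 - m2.
  have -> : - x / 2 + r / 2 * y = p.1 * u2 + p.2 * v2 + m1 / 2 - r * n / 2.
    by rewrite /x /y /u2 /v2; field.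
  by rewrite rn; lra.
have x3 : - x / 2 - r / 2 * y = p.1 * u3 + p.2 * v3 - m3.
  have -> : - x / 2 - r / 2 * y = p.1 * u3 + p.2 * v3 + m1 / 2 + r * n / 2.
    by rewrite /x /y /u3 /v3; field.
  by rewrite rn; lra.
have [] := hexagon_cover R r x y r2.
- exact: strip.
- by rewrite x2; exact: strip.
- by rewrite x3; exact: strip.
- by move=> h; constructor 1; rewrite E; lra.
- by move=> h; constructor 2; rewrite E; lra.
- by move=> h; constructor 3; rewrite E; lra.
Qed.

(** * From covered centers to piercing numbers *)

(** The cardinality of [X] is a positive candidate, so a least one exists. It is only bounded by [n]
    because piercing points may coincide. *)
Lemma is_piercing_number_le (R : realType) (d : nat) (F : set (set 'rV[R]_d))
    (n : nat) (X : set 'rV[R]_d) :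
  X !=set0 -> (X #<= `I_n)%card -> pierces X F ->
  exists2 m, is_piercing_number F m & (m <= n)%N.
Proof.
move=> [x Xx] Xn XF.
have [j Xj] : exists j, (X #= `I_j)%card.
  by apply/finite_setP/finite_set_leP; exists n.
have j0 : (0 < j)%N.
  rewrite lt0n; apply/negP => /eqP j0; move: Xj.
  by rewrite j0 II0 card_eq0 => /eqP X0; rewrite X0 in Xx.
pose Q i := (0 < i)%N && `[< pierceable F i >].
have exQ : exists i, Q i by exists j; rewrite /Q j0; apply/asboolP; exists X.
exists (ex_minn exQ); case: ex_minnP => i /andP[i0 /asboolP Fi] imin.
  by split => // l l0 Fl; apply: imin; rewrite /Q l0; apply/asboolP.
apply: (leq_trans (imin j _)); first by rewrite /Q j0; apply/asboolP; exists X.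
by move: Xn; rewrite -card_le_II (card_le_eql Xj).
Qed.

Definition point {R : realType} (c : 'rV[R]_2) : R * R := (c 0 0, c 0 1).

Lemma eucl_dist_le (R : realType) (c x : 'rV[R]_2) :
  (eucl_dist c x <= 1 / 2) = (sqdist (point c) (point x) <= 1/4).
Proof.
rewrite /eucl_dist !big_ord_recl big_ord0 addr0.
have -> : lift ord0 ord0 = 1 :> 'I_2 by apply/val_inj.
rewrite -/(sqdist (point c) (point x)).
have -> : 1/2 = Num.sqrt (1/4) :> R.
  rewrite (_ : 1/4 = (1/2)^+2) ?sqrtr_sqr; last by field.
  by rewrite ger0_norm //; lra.
by rewrite ler_sqrt //; lra.
Qed.

Lemma is_piercing_number_cover (R : realType) (F : set (set 'rV[R]_2))
    (S : set (R * R)) :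
  (forall B, F B -> exists2 c, B = closed_disk c 1 & S (point c)) ->
  covered_by_three S ->
  exists2 n, is_piercing_number F n & (n <= 3)%N.
Proof.
move=> FS [w1 [w2 [w3 cov]]].
pose vec (w : R * R) : 'rV[R]_2 := \row_j (if j == 0 then w.1 else w.2).
have vecK w : point (vec w) = w by rewrite /point !mxE; case: w.
pose g i := vec (nth 0 [:: w1; w2; w3] i).
apply: (@is_piercing_number_le R 2 F 3 [set g i | i in `I_3]).
- by exists (g 0%N), 0%N.
- exact: card_image_le.
move=> B FB; have [c -> /cov[]h] := FS B FB.
- by exists (vec w1); split; [exists 0%N|rewrite /closed_disk /= eucl_dist_le vecK].
- by exists (vec w2); split; [exists 1%N|rewrite /closed_disk /= eucl_dist_le vecK].
- by exists (vec w3); split; [exists 2%N|rewrite /closed_disk /= eucl_dist_le vecK].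
Qed.

(** By the parallelogram law at a common point [x], |c - c'|^2 <= 2|c - x|^2 + 2|c' - x|^2. *)
Lemma closed_disk_meet (R : realType) (c c' : 'rV[R]_2) :
  closed_disk c 1 `&` closed_disk c' 1 !=set0 ->
  sqdist (point c) (point c') <= 1.
Proof.
move=> [x [] ]; rewrite /closed_disk /= !eucl_dist_le /sqdist /=.
have : 0 <= (c 0 0 - x 0 0 + (c' 0 0 - x 0 0))^+2 by rewrite sqr_ge0.
have : 0 <= (c 0 1 - x 0 1 + (c' 0 1 - x 0 1))^+2 by rewrite sqr_ge0.
nra.
Qed.

Theorem theorem1p4 (R : realType) (k : nat) (hk : (2 <= k)%N)
    (P : 'I_k -> set (set 'rV[R]_2))
    (Pfin : forall i : 'I_k, finite_set (P i))
    (Pdisk : forall (i : 'I_k) (B : set 'rV[R]_2),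
       P i B -> exists c : 'rV[R]_2, B = closed_disk c 1)
    (Pmeet : forall i j : 'I_k, i != j ->
       forall B' B'' : set 'rV[R]_2, P i B' -> P j B'' ->
       B' `&` B'' !=set0) :
  exists m : 'I_k,
    exists2 n : nat,
      is_piercing_number (\bigcup_(i in [set i : 'I_k | i != m]) P i) n &
      (n <= 3)%N.
Proof.
have [[i [j [c [c' [Pc Pc' far]]]]]|near] := pselect (exists i j c c',
  [/\ P i (closed_disk c 1), P j (closed_disk c' 1)
    & (23/20) ^+ 2 <= sqdist (point c) (point c')]).
  (* Disks of different families meet, so their centers are at distance at most 1 < 23/20. *)
  have ij : i = j.
    apply/eqP/negPn/negP => ij.
    have := closed_disk_meet _ _ _ (Pmeet i j ij _ _ Pc Pc'); lra.
  subst j; exists i; apply: is_piercing_number_cover (far_pair_cover _ _ _ far).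
  move=> B [l /= li PB]; have [q Bq] := Pdisk l B PB; exists q => //.
  by split; apply: closed_disk_meet; rewrite -Bq; apply: (Pmeet l i).
have /finite_seqP[D eD] : finite_set (\bigcup_(i in [set: 'I_k]) P i).
  by apply: bigcup_finite => // i _; exact: Pfin.
(* One center per disk; sets outside all families get the default 0. *)
have /choice[ctr ctrP] (B : set 'rV[R]_2) :
    exists c, (exists i, P i B) -> B = closed_disk c 1.
  have [[i /Pdisk[c ->]]|none] := pselect (exists i, P i B); first by exists c.
  by exists 0.
have PD i B : P i B -> B \in D.
  move=> PB; suff: [set` D] B by [].
  by rewrite -eD; exists i.
have DP B : B \in D -> exists2 i, P i B & B = closed_disk (ctr B) 1.
  move=> BD; have [i _ PB] : (\bigcup_(i in [set: 'I_k]) P i) B by rewrite eD.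
  by exists i => //; apply: ctrP; exists i.
(* Any index would do here: all centers, even within one family, are pairwise close. *)
exists (Ordinal (ltnW hk)).
apply: (@is_piercing_number_cover R _ [set` [seq point (ctr B) | B <- D]]).
  move=> B [i _ /PD BD]; exists (ctr B); first by have [] := DP B BD.
  exact: map_f.
apply: small_diameter_cover => _ _ /mapP[B BD ->] /mapP[B' BD' ->].
rewrite leNgt; apply/negP => /ltW far; apply: near.
have [i PB EB] := DP B BD; have [j PB' EB'] := DP B' BD'.
by exists i, j, (ctr B), (ctr B'); split; rewrite -?EB -?EB'.
Qed.
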